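(* Let $p\equiv 1 \pmod 4$ be a prime such that the multiplicative order of $2$ modulo $p$ is divisible by $4$. Then the edge set of the complete graph $K_p$ can be partitioned into pairwise edge-disjoint copies of $C_p^2$. Moreover, the hypothesis on the order of $2$ holds in particular for every prime $p\equiv 5\pmod 8$.
   Context: $C_p^2$ denotes the square of the cycle $C_p$ on $p$ vertices, i.e. the graph on the vertices of $C_p$ in which two vertices are adjacent if their distance in $C_p$ is at most two (the square of a Hamilton cycle of $K_p$). *)

(* Defs.v *)
From HB Require Import structures.
From mathcomp Require Import all_boot all_order all_fingroup all_algebra.
From mathcomp Require Import cyclic.

Set Implicit Arguments.
Unset Strict Implicit.
Unset Printing Implicit Defensive.

(* Finite simple graphs with vertex set the whole of [T]. *)
Record sgraph (T : finType) := SGraph {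
  adj :> rel T;
  adj_sym : symmetric adj;
  adj_irr : irreflexive adj }.

Definition edges (T : finType) (G : sgraph T) : {set {set T}} :=
  [set [set x; y] | x in T, y in T & G x y].

Section Complete.
Variable T : finType.

Lemma complete_sym : symmetric (fun x y : T => x != y).
Proof. by move=> x y; rewrite eq_sym. Qed.

Lemma complete_irr : irreflexive (fun x y : T => x != y).
Proof. by move=> x; rewrite eqxx. Qed.

Definition complete : sgraph T := SGraph complete_sym complete_irr.

End Complete.

Section Cycle.
Variable n : nat.

(* [ordS] is the successor modulo [n]; the test [i != j] only matters for
   [n = 1], where it removes a loop. *)
Definition cycle_adj (i j : 'I_n) : bool :=
  (i != j) && ((j == ordS i) || (i == ordS j)).

Lemma cycle_sym : symmetric cycle_adj.
Proof. by move=> i j; rewrite /cycle_adj eq_sym orbC. Qed.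

Lemma cycle_irr : irreflexive cycle_adj.
Proof. by move=> i; rewrite /cycle_adj eqxx. Qed.

Definition cycle_graph : sgraph 'I_n := SGraph cycle_sym cycle_irr.

End Cycle.

Section Power.
Variables (T : finType) (G : sgraph T).

(* [x] and [y] are at distance at most [k]: some walk of length [m <= k] joins
   them. *)
Definition dist_le (k : nat) (x y : T) : bool :=
  [exists m : 'I_k.+1, exists s : m.-tuple T, path G x s && (last x s == y)].

Lemma dist_le_sym k : symmetric (dist_le k).
Proof.
suff H x y : dist_le k x y -> dist_le k y x.
  by move=> x y; apply/idP/idP; apply: H.
case/existsP=> m /existsP[s /andP[ps /eqP ls]].
have sz : size (rev (belast x s)) == m by rewrite size_rev size_belast size_tuple.
apply/existsP; exists m; apply/existsP; exists (Tuple sz) => /=.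
rewrite -{1}ls rev_path (eq_path (e' := G)) ?ps /=; last first.
  by move=> u v; rewrite adj_sym.
by case: (tval s) ls => [|a t] /= ls; rewrite ?rev_cons ?last_rcons ?ls.
Qed.

Definition power_adj (k : nat) (x y : T) : bool := (x != y) && dist_le k x y.

Lemma power_sym k : symmetric (power_adj k).
Proof. by move=> x y; rewrite /power_adj eq_sym dist_le_sym. Qed.

Lemma power_irr k : irreflexive (power_adj k).
Proof. by move=> x; rewrite /power_adj eqxx. Qed.

Definition power (k : nat) : sgraph T := SGraph (power_sym k) (power_irr k).

End Power.

(* [A] is the edge set of a copy of [H] on vertices taken from [T]. *)
Definition is_copy (U T : finType) (H : sgraph U) (A : {set {set T}}) : Prop :=
  exists f : U -> T,
    injective f /\ A = [set f @: e | e : {set U} in edges H].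

(* The edge set of [G] is partitioned into edge sets of copies of [H]; being
   blocks of a partition of [edges G], these copies are subgraphs of [G]. *)
Definition decomposes (T U : finType) (G : sgraph T) (H : sgraph U) : Prop :=
  exists P : {set {set {set T}}},
    partition P (edges G) /\ forall A, A \in P -> is_copy H A.

(* The order of [a] in the unit group of Z/n; only meaningful for [1 < n] and
   [a] coprime to [n] ([insubd] returns the unit [1] otherwise). *)
Definition mult_order (a n : nat) : nat :=
  #[insubd (1%g : {unit 'Z_n}) (a%:R)%R]%g.

Lemma mult_orderP (a n k : nat) : 1 < n -> coprime a n ->
  (mult_order a n %| k) = (a ^ k == 1 %[mod n]).
Proof.
move=> n_gt1 co_an; rewrite /mult_order order_dvdn -val_eqE /=.
rewrite FinRing.val_unitX val_insubd unitZpE // coprime_sym co_an.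
by rewrite -GRing.natrX -val_eqE /= val_Zp_nat // Zp_cast.
Qed.

(* Main.v *)
(** Work in [F_p].  Since [4] divides the order of [2], [-1] is an even power of
    [2]; so [<4>] contains [-1] and has index [2] in [<2>], and colouring every
    coset of [<2>] by the two cosets of [<4>] gives a colouring of the nonzero
    elements that is invariant under negation and switched by doubling.  The
    nonzero elements are thus partitioned into the sets [{s, -s, 2s, -2s}] with
    [s] of the first colour, and the edges whose difference lies in such a set
    form the square of the Hamilton cycle [0, s, 2s, ...].  When [p = 5 mod 8],
    a root [i] of [-1] satisfies [(1 + i)^2 = 2i], whence [2^((p-1)/2) = -1]. *)
Require Import Defs.
From mathcomp Require Import all_boot all_order all_fingroup all_algebra.
From mathcomp Require Import cyclic finfield zify ring.

Set Implicit Arguments.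
Unset Strict Implicit.
Unset Printing Implicit Defensive.

Import GRing.Theory.

(** * Cyclic groups of even order *)

Section SquareIndexTwo.
Local Open Scope group_scope.
Variables (gT : finGroupType) (g : gT).
Hypothesis ev : 2 %| #[g].

(** As [#[g]] is even, [g ^+ 2] has half the order of [g], so [<[g ^+ 2]>] is too small to contain
    [g]. *)
Lemma notin_cycle_sqr : g \notin <[g ^+ 2]>.
Proof.
apply/negP => gin; have := order_dvdG gin.
rewrite -orderE (orderXdiv ev) => /dvdn_leq.
by have := order_gt0 g; move: ev; lia.
Qed.

Lemma mulg_cycle_sqr y :
  y \in <[g]> -> (g * y \in <[g ^+ 2]>) = (y \notin <[g ^+ 2]>).
Proof.
case/cycleP=> i ->; apply/idP/idP => [gy|].
  apply: contra notin_cycle_sqr => yin.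
  by rewrite -(groupMr _ yin).
rewrite -expgS -(odd_double_half i); case: (odd i) => /= [_|].
  by rewrite add1n -doubleS -muln2 mulnC expgM mem_cycle.
by rewrite add0n -muln2 mulnC expgM mem_cycle.
Qed.

End SquareIndexTwo.

(** * Colouring the nonzero elements of a finite field *)

Section UnitColouring.
Variables (F : finFieldType) (u : {unit F}).
Hypothesis ord4 : 4 %| #[u]%g.

(** The element [w] is [u] raised to half its order, an even exponent because [4] divides the order.
    It is an involution, and the only one in a field is [-1]. *)
Lemma opp1_in_cycle_sqr (m : {unit F}) :
  val m = (-1)%R -> (m \in <[u ^+ 2]>)%g.
Proof.
move=> vm; have o_gt0 := order_gt0 u.
pose w := (u ^+ (2 * (#[u] %/ 4)))%g.
have w2 : (w ^+ 2)%g = 1%g.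
  rewrite -expgM; apply/eqP; rewrite -order_dvdn.
  by have -> : 2 * (#[u]%g %/ 4) * 2 = #[u]%g by move: ord4; lia.
have w1 : w != 1%g.
  rewrite -order_dvdn; apply/negP => /dvdn_leq; move: ord4 o_gt0; lia.
suff -> : m = w by rewrite /w expgM mem_cycle.
apply: val_inj; rewrite /= vm.
have /eqP : ((val w) ^+ 2 = 1)%R by rewrite -FinRing.val_unitX w2.
rewrite -subr_eq0 subr_sqr_1 mulf_eq0 subr_eq0 addr_eq0 => /orP[]/eqP e //.
by case/eqP: w1; apply: val_inj.
Qed.

Lemma unit_colouring : exists c : F -> bool,
  [/\ forall x, c (- x)%R = c x
    & forall x, x != 0%R -> c (val u * x)%R = ~~ c x].
Proof.
(* The colour records whether [x] divided by the representative of its [<[u]>]-coset is an even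
   power of [u]. [U] sends [0] to the default [1], so [0] merely inherits the colour of [1]. *)
pose r (x : {unit F}) := repr (<[u]> :* x)%g.
pose c0 (x : {unit F}) := (x * (r x)^-1 \in <[u ^+ 2]>)%g.
pose U (x : F) : {unit F} := insubd (1%g : {unit F}) x.
have Uv x : x != 0%R -> val (U x) = x by move=> x0; rewrite val_insubd unitfE x0.
have ev : 2 %| #[u]%g by apply: dvdn_trans ord4.
have rM y x : (y \in <[u]> -> r (y * x) = r x)%g.
  by move=> yu; rewrite /r rcosetM rcoset_id.
have in_cyc x : (x * (r x)^-1 \in <[u]>)%g.
  by rewrite -groupV invMg invgK -mem_rcoset; apply: mem_repr_rcoset.
exists (fun x => c0 (U x)); split=> x; last first.
  move=> x0; have -> : U (val u * x)%R = (u * U x)%g.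
    apply: val_inj; rewrite Uv /= ?Uv // mulf_neq0 //.
    by have := valP u; rewrite unitfE.
  by rewrite /c0 rM ?cycle_id // -mulgA mulg_cycle_sqr.
have [->|x0] := eqVneq x 0%R; first by rewrite oppr0.
have vm : val (U (-1)%R) = (-1)%R by rewrite Uv // oppr_eq0 oner_eq0.
have mi := opp1_in_cycle_sqr vm.
have -> : U (- x)%R = (U (-1)%R * U x)%g.
  by apply: val_inj; rewrite Uv ?oppr_eq0 //= vm Uv // mulN1r.
(* Lying in [<[u]>], [-1] leaves the coset representative unchanged. *)
rewrite /c0 rM; last by move: mi; apply/subsetP; rewrite cycle_subG mem_cycle.
by rewrite -mulgA groupMl.
Qed.

End UnitColouring.

(** * Edge sets, and adjacency in the square of a cycle *)

Lemma edgesP (T : finType) (G : sgraph T) (e : {set T}) :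
  reflect (exists x y, e = [set x; y] /\ G x y) (e \in edges G).
Proof.
apply: (iffP imset2P) => [[x y _]|[x [y [-> xy]]]].
  by rewrite inE => /andP[_ xy] ->; exists x, y.
by exists x y; rewrite ?inE.
Qed.

Lemma edges2 (T : finType) (G : sgraph T) (x y : T) :
  ([set x; y] \in edges G) = G x y.
Proof.
apply/edgesP/idP => [[a [b [e ab]]]|xy]; last by exists x, y.
have : a != b by apply: contraTneq ab => ->; rewrite adj_irr.
have : a \in [set x; y] by rewrite e !inE eqxx.
have : b \in [set x; y] by rewrite e !inE eqxx orbT.
rewrite !inE => /orP[]/eqP eb /orP[]/eqP ea; move: ab; rewrite ea eb ?eqxx //.
by rewrite adj_sym.
Qed.

Section CycleSquare.
Local Open Scope ring_scope.
Variable n : nat.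
Implicit Types x y s d : 'I_n.+2.

Lemma ordS_Zp x : ordS x = x + 1.
Proof. by apply: val_inj; rewrite /= modnDmr addn1. Qed.

(** The ring structure on ['I_n.+2] is nontrivial, so a difference of [1] or [-1] already rules out
    [x = y]. *)
Lemma cycle_adj_Zp x y :
  cycle_graph n.+2 x y = (x - y == 1) || (x - y == -1).
Proof.
rewrite /= /cycle_adj !ordS_Zp.
have -> : (y == x + 1) = (x - y == -1).
  by rewrite -[RHS](inj_eq (@oppr_inj _)) opprK opprB subr_eq addrC.
have -> : (x == y + 1) = (x - y == 1) by rewrite subr_eq addrC.
have [->|_] := eqVneq x y; last by rewrite orbC.
by rewrite subrr ![0 == _]eq_sym oppr_eq0 oner_eq0.
Qed.

Lemma cycle_square_adj x y : power (cycle_graph n.+2) 2 x y =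
  (x != y) && [|| x - y == 1, x - y == -1, x - y == 2 | x - y == -2].
Proof.
rewrite /= /power_adj; have [->|xy] //= := eqVneq x y.
apply/existsP/idP => [[[m lt_m] /existsP[[s /= /eqP sz]]]|].
  case: s sz => [|a [|b [|d s]]] sz /andP[/= + /eqP /= ly].
  - by rewrite ly eqxx in xy.
  - by rewrite andbT -[cycle_adj x a]/(cycle_graph n.+2 x a) cycle_adj_Zp ly
      => /orP[]->; rewrite ?orbT.
  - rewrite andbT -[cycle_adj x a]/(cycle_graph n.+2 x a).
    rewrite -[cycle_adj a b]/(cycle_graph n.+2 a b) !cycle_adj_Zp ly.
    (* The difference is a sum of two signs; opposite signs would force [x = y]. *)
    have -> : x - y = (x - a) + (a - y) by ring.
    case/andP=> /orP[]/eqP ex /orP[]/eqP ea; move: xy;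
      rewrite -subr_eq0 -(subrKA a) ex ea ?subrr ?addNr ?eqxx // => _.
      by rewrite !orbT.
    by rewrite -opprD eqxx !orbT.
  - by move: lt_m; rewrite -sz.
have ce := cycle_adj_Zp; rewrite /= in ce.
case/or4P => /eqP e.
- exists (@Ordinal 3 1 isT); apply/existsP; exists [tuple y].
  by rewrite /= ce e !eqxx.
- exists (@Ordinal 3 1 isT); apply/existsP; exists [tuple y].
  by rewrite /= ce e !eqxx orbT.
(* The midpoint of the walk is [y + 1] here and [y - 1] in the last case. *)
- exists (@Ordinal 3 2 isT); apply/existsP; exists [tuple y + 1; y].
  rewrite /= !ce eqxx andbT.
  have -> : x - (y + 1) = (x - y) - 1 by ring.
  have -> : y + 1 - y = 1 by ring.
  by rewrite e addrK !eqxx.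
- exists (@Ordinal 3 2 isT); apply/existsP; exists [tuple y - 1; y].
  rewrite /= !ce eqxx andbT.
  have -> : x - (y - 1) = (x - y) + 1 by ring.
  have -> : y - 1 - y = -1 by ring.
  by rewrite e opprD addrNK !eqxx !orbT.
Qed.

End CycleSquare.

(** * Decomposing the complete graph by dilated cycle squares *)

Section Decomposition.
Local Open Scope ring_scope.
Variables (p : nat) (c : 'F_p -> bool).
Hypothesis two0 : 2 != 0 :> 'F_p.
Hypothesis cN : forall x, c (- x) = c x.
Hypothesis c2 : forall x, x != 0 -> c (2 * x) = ~~ c x.

(** ['F_p] unfolds to the ordinals below this bound, so the vertices of the cycle are literally the
    field elements; for prime [p] the bound is [p]. *)
Notation C2 := (power (cycle_graph (Zp_trunc (pdiv p)).+2) 2).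

Definition dilated_square (s : 'F_p) : {set {set 'F_p}} :=
  [set (fun i : 'F_p => i * s) @: e | e : {set 'F_p} in edges C2].

Lemma mem_dilated_square (s x y : 'F_p) : s != 0 ->
  ([set x; y] \in dilated_square s) =
  (x != y) && [|| x - y == s, x - y == - s, x - y == 2 * s | x - y == - (2 * s)].
Proof.
move=> s0; have injs : injective (fun i : 'F_p => i * s) by apply: mulIf.
have -> : [set x; y] = (fun i : 'F_p => i * s) @: [set x / s; y / s].
  by rewrite imsetU1 imset_set1 !divfK.
rewrite mem_imset; last exact: imset_inj.
rewrite edges2 cycle_square_adj (inj_eq (divIf s0)) -mulrBl.
have eqs d : ((x - y) / s == d) = (x - y == d * s).
  by apply/eqP/eqP => [<-|->]; rewrite ?divfK ?mulfK.
by rewrite !eqs !mulNr mul1r.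
Qed.

Lemma dilated_squareN s : s != 0 -> dilated_square (- s) = dilated_square s.
Proof.
move=> s0; apply/setP => e.
(* [mem_dilated_square] speaks only of sets written as pairs; any other set lies in no dilated
   square. *)
have sub t : dilated_square t \subset [set [set z.1; z.2] | z : 'F_p * 'F_p].
  apply/subsetP => _ /imsetP[_ /edgesP[a [b [-> _]]] ->].
  apply/imsetP; exists (a * t, b * t) => //=.
  by rewrite imsetU1 imset_set1.
have [/imsetP[[x y] _ ->]|ne] := boolP (e \in [set [set z.1; z.2] | z : 'F_p * 'F_p]).
  rewrite !mem_dilated_square ?oppr_eq0 //= mulrN !opprK.
  by congr (_ && _); do 4 case: (_ == _).
have out t : (e \in dilated_square t) = false.
  by apply: contraNF ne; apply/subsetP.
by rewrite !out.
Qed.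

Lemma decomposes_of_colouring : decomposes (complete 'F_p) C2.
Proof.
exists [set dilated_square s | s in [set s | (s != 0) && c s]]; split; last first.
  move=> A /imsetP[s]; rewrite inE => /andP[s0 _] ->.
  by exists (fun i : 'F_p => i * s); split => //; apply: mulIf.
have edgeE e s : s != 0 -> e \in dilated_square s ->
  exists x y : 'F_p, e = [set x; y] /\ x != y.
  move=> s0 es; case/imsetP: (es) => _ /edgesP[a [b [-> _]]].
  rewrite imsetU1 imset_set1 => ee; exists (a * s), (b * s); split=> //.
  by move: es; rewrite ee mem_dilated_square // => /andP[].
apply/and3P; split.
- rewrite eqEsubset; apply/andP; split; apply/subsetP => e.
    case/bigcupP => A /imsetP[s]; rewrite inE => /andP[s0 cs] -> /edgeE[] //.
    by move=> x [y [-> xy]]; rewrite edges2.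
  case/edgesP => x [y [-> xy]]; rewrite /= -subr_eq0 in xy.
  have [cd|cd] := boolP (c (x - y)).
    apply/bigcupP; exists (dilated_square (x - y)).
      by apply: imset_f; rewrite inE xy.
    by rewrite mem_dilated_square // -subr_eq0 xy eqxx.
  (* Halving a difference of the wrong colour gives one of the right colour. *)
  have h0 : (x - y) / 2 != 0 by rewrite mulf_neq0 ?invr_eq0.
  have h2 : 2 * ((x - y) / 2) = x - y by rewrite mulrC divfK.
  apply/bigcupP; exists (dilated_square ((x - y) / 2)).
    by apply: imset_f; rewrite inE h0 -[c _]negbK -c2 // h2.
  by rewrite mem_dilated_square // h2 -subr_eq0 xy eqxx !orbT.
- apply/trivIsetP => _ _ /imsetP[s + ->] /imsetP[t + ->].
  rewrite !inE => /andP[s0 cs] /andP[t0 ct].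
  apply: contraR => /pred0Pn[e /andP[/= es et]].
  have [x [y [ee xy]]] := edgeE _ _ s0 es.
  move: es et; rewrite ee !mem_dilated_square // xy /=.
  move: (x - y) => d es et.
  suff : s = t \/ s = - t by case=> ->; rewrite ?dilated_squareN.
  have c2s : c (2 * s) = false by rewrite c2 // cs.
  have c2t : c (2 * t) = false by rewrite c2 // ct.
  have switch (a b : 'F_p) : c a != c b -> a = b -> False.
    by move=> + e'; rewrite e' eqxx.
  have m2 := mulfI two0.
  (* Of the sixteen cases, the eight equating a multiple by 1 or -1 with one by 2 or -2 contradict
     the colours; the others yield [s = t] or [s = - t]. *)
  case/or4P: es et => /eqP -> /or4P[] /eqP e1;
    try (by case: (switch _ _ _ e1); rewrite ?cN ?cs ?ct ?c2s ?c2t).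
  + by left.
  + by right.
  + by right; rewrite -e1 opprK.
  + by left; apply: oppr_inj.
  + by left; apply: m2.
  + by right; apply: m2; rewrite mulrN.
  + by right; apply: m2; rewrite mulrN -e1 opprK.
  + by left; apply: m2; apply: oppr_inj.
- apply/imsetP => -[s]; rewrite inE => /andP[s0 _] /setP/(_ [set s; 0]).
  by rewrite mem_dilated_square // subr0 s0 eqxx inE.
Qed.

End Decomposition.

(** * Square roots of -1 and the order of two modulo a prime *)

Lemma Fp_two_expn_eq1 (p k : nat) : prime p ->
  ((2 ^+ k == 1 :> 'F_p)%R) = (2 ^ k == 1 %[mod p]).
Proof.
by move=> pp; rewrite -natrX -val_eqE /= val_Fp_nat // Fp_cast.
Qed.

(** The two orders live in the unit groups of ['Z_p] and ['F_p], so they are compared through the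
    exponents they divide. *)
Lemma mult_order_two_Fp (p : nat) (u : {unit 'F_p}) : prime p -> odd p ->
  val u = (2%:R)%R -> mult_order 2 p = #[u]%g.
Proof.
move=> pp op vu.
have e k : (mult_order 2 p %| k) = (#[u]%g %| k).
  rewrite mult_orderP ?prime_gt1 ?coprime2n // -Fp_two_expn_eq1 //.
  by rewrite order_dvdn -[RHS]val_eqE /= FinRing.val_unitX vu.
by apply/eqP; rewrite eqn_dvd e dvdnn -e dvdnn.
Qed.

Lemma Fp_two_neq0 (p : nat) : prime p -> odd p -> (2 != 0 :> 'F_p)%R.
Proof.
move=> pp op; rewrite -(dvdn_pcharf (pchar_Fp pp)).
by apply/negP => /dvdn_leq; move: op (prime_gt1 pp); case: p {pp} => [|[|[|]]] //; lia.
Qed.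

(** The root is [g] to the power [(p - 1) / 4] for a generator [g] of the units: its square squares
    to [1], but is not [1] as [g] has order [p - 1]. *)
Lemma Fp_sqrtN1 (p : nat) : prime p -> p = 1 %[mod 4] ->
  exists i : 'F_p, (i ^+ 2 = -1)%R.
Proof.
move=> pp p1.
have /cyclicP[g Eg] := field_unit_group_cyclic [group of [set: {unit 'F_p}]%g].
have og : #[g]%g = p.-1.
  by rewrite orderE -Eg card_units_Zp ?pdiv_gt0 // pdiv_id // totient_prime.
have p_gt1 := prime_gt1 pp.
pose i := (val g ^+ (p.-1 %/ 4))%R; exists i.
have i4 : ((i ^+ 2) ^+ 2 = 1)%R.
  rewrite /i -!exprM (_ : _ * (2 * 2) = p.-1); last by lia.
  by rewrite -FinRing.val_unitX -og expg_order.
have /eqP := i4; rewrite -subr_eq0 subr_sqr_1 mulf_eq0 subr_eq0 addr_eq0.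
case/orP=> /eqP // i2; exfalso.
have : (g ^+ (p.-1 %/ 4 * 2) == 1)%g.
  by rewrite -val_eqE /= FinRing.val_unitX exprM i2.
by rewrite -order_dvdn og => /dvdn_leq; lia.
Qed.

Lemma Fp_two_half_power (p : nat) : prime p -> p = 5 %[mod 8] ->
  (2 ^+ (p.-1 %/ 2) = -1 :> 'F_p)%R.
Proof.
move=> pp p5; have p_gt1 := prime_gt1 pp.
have two0 : (2 != 0 :> 'F_p)%R by apply: Fp_two_neq0 => //; lia.
have [|i i2] := Fp_sqrtN1 pp; first lia.
have i0 : (i != 0)%R.
  by apply: contraNneq (oner_neq0 'F_p) => i0; rewrite -oppr_eq0 -i2 i0 expr0n.
have j0 : (1 + i != 0)%R.
  (* If [i = -1], then [-1 = i ^+ 2 = 1], that is, [2 = 0]. *)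
  apply: contraNneq two0 => /eqP; rewrite addr_eq0 => /eqP e.
  by rewrite -[2%R]/(1 + 1)%R addr_eq0 -i2 -sqrrN -e expr1n.
have fermat (x : 'F_p) : x != 0%R -> (x ^+ p.-1 = 1)%R.
  move=> x0; apply: (mulfI x0); rewrite -exprS prednK ?prime_gt0 // mulr1.
  by have := expf_card x; rewrite card_Fp.
have h : (2 * i = (1 + i) ^+ 2)%R by rewrite sqrrD i2; ring.
have ih : (i ^+ (p.-1 %/ 2) = -1)%R.
  (* For [p = 5] modulo [8], [(p - 1) / 2] is twice an odd number. *)
  have -> : p.-1 %/ 2 = 2 * (2 * (p.-1 %/ 8)).+1 by lia.
  by rewrite exprM i2 exprS exprM sqrrN expr1n expr1n mulr1.
have : ((2 * i) ^+ (p.-1 %/ 2) = 1)%R.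
  rewrite h -exprM (_ : 2 * _ = p.-1); last lia.
  exact: fermat.
by rewrite exprMn ih mulrN1 => e; rewrite -[LHS]opprK e.
Qed.

Theorem theorem1p2 :
  (forall p : nat, prime p -> p = 1 %[mod 4] -> 4 %| mult_order 2 p ->
     decomposes (complete 'I_p) (power (cycle_graph p) 2)) /\
  (forall p : nat, prime p -> p = 5 %[mod 8] -> 4 %| mult_order 2 p).
Proof.
split=> p pp.
  move=> p1 o4; have op : odd p by lia.
  have two0 := Fp_two_neq0 pp op.
  have tu : ((2 : 'F_p) \is a GRing.unit)%R by rewrite unitfE.
  rewrite (@mult_order_two_Fp p (FinRing.unit _ tu)) // in o4.
  have [c [cN c2]] := unit_colouring o4.
  by have := decomposes_of_colouring two0 cN c2; rewrite Fp_cast.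
move=> p5; have op : odd p by lia.
have p_gt1 := prime_gt1 pp.
have two0 := Fp_two_neq0 pp op; have h := Fp_two_half_power pp p5.
have d1 : mult_order 2 p %| p.-1.
  rewrite mult_orderP ?coprime2n // -Fp_two_expn_eq1 //.
  have -> : p.-1 = p.-1 %/ 2 * 2 by lia.
  by rewrite exprM h sqrrN expr1n.
have d2 : ~~ (mult_order 2 p %| p.-1 %/ 2).
  rewrite mult_orderP ?coprime2n // -Fp_two_expn_eq1 // h.
  by rewrite eq_sym -subr_eq0 opprK.
case/dvdnP: d1 => k ek.
(* An even cofactor [k] would make the order divide [(p - 1) / 2]. *)
have ok : odd k.
  apply: contraNT d2 => ek2; apply/dvdnP; exists (k %/ 2).
  by rewrite ek; move: (mult_order 2 p) ek => m _; rewrite divn_mulAC //; lia.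
(* [4] divides [p - 1 = k * mult_order 2 p] and is coprime to the odd [k]. *)
rewrite -(@Gauss_dvdr 4 k) -?ek; first by lia.
by rewrite (@coprime_pexpl 2 2) // coprime2n.
Qed.
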